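(* Every normal formula $\phi$ of $\mathcal{L}$ is equivalent in $\Sigma_H$ to a formula of depth $\le1$; that is, there is a formula $\phi'$ of depth at most $1$ with $\phi\leftrightarrow\phi'\in\Sigma_H$.
   Context: Language $\mathcal{L}$: formulas are given by $\phi ::= p \mid \neg\phi \mid \phi_1\wedge\phi_2 \mid L_r\phi$, with $p$ from a countably infinite set of propositional letters and $r\in\mathbb{Q}\cap[0,1]$. The depth is defined by $dp(p)=0$, $dp(\neg\phi)=dp(\phi)$, $dp(\phi_1\wedge\phi_2)=\max\{dp(\phi_1),dp(\phi_2)\}$, $dp(L_r\phi)=dp(\phi)+1$. A formula is normal if it is obtained inductively as follows: (1) any formula of depth $\le1$ is normal; (2) if $L_{r_1}\phi_1,\dots,L_{r_n}\phi_n$ are normal, then any Boolean combination of them is normal; (3) if $L_r\phi$ with $r>0$ is normal and $\psi$ is a Boolean combination of normal formulas of the form $L_s\psi'$ with $s>0$, then $L_r\psi$, $L_r(\phi\wedge\psi)$ and $L_r(\phi\vee\psi)$ are normal. A logic is a set of formulas containing all propositional tautologies and closed under modus ponens and uniform substitution. $\Sigma_H$ is the smallest logic containing (A1) $L_0\phi$; (A2) $L_r\top$; (A3) $L_r(\phi\wedge\psi)\wedge L_t(\phi\wedge\neg\psi)\to L_{r+t}\phi$ for $r+t\le 1$; (A4) $\neg L_r(\phi\wedge\psi)\wedge\neg L_s(\phi\wedge\neg\psi)\to\neg L_{r+s}\phi$ for $r+s\le1$; (A5) $L_r\phi\to\neg L_s\neg\phi$ for $r+s>1$; $(4_p)$ $L_r\phi\to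 L_1L_r\phi$; $(5_p)$ $\neg L_r\phi\to L_1\neg L_r\phi$; and closed under (DIS): from $\phi\leftrightarrow\psi$ infer $L_r\phi\leftrightarrow L_r\psi$; and (ARCH): if $\gamma\to L_s\phi$ is a theorem for all $s<r$, then $\gamma\to L_r\phi$ is a theorem. All indices are rationals in $[0,1]$. *)

(* Defs.v *)
From mathcomp Require Import all_boot all_order all_algebra.

Set Implicit Arguments.
Unset Strict Implicit.
Unset Printing Implicit Defensive.

Import Order.TTheory GRing.Theory Num.Theory.
Local Open Scope ring_scope.

Definition index := {r : rat | 0 <= r <= 1}.

Definition index0 : index := exist _ 0 isT.
Definition index1 : index := exist _ 1 isT.

Inductive formula : Type :=
| Var of nat
| Neg of formula
| And of formula & formula
| L of index & formula.

Fixpoint depth (phi : formula) : nat :=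
  match phi with
  | Var _ => 0
  | Neg phi1 => depth phi1
  | And phi1 phi2 => maxn (depth phi1) (depth phi2)
  | L _ phi1 => (depth phi1).+1
  end.

Definition Or (phi psi : formula) : formula := Neg (And (Neg phi) (Neg psi)).
Definition Imp (phi psi : formula) : formula := Neg (And phi (Neg psi)).
Definition Iff (phi psi : formula) : formula := And (Imp phi psi) (Imp psi phi).
Definition Top : formula := Neg (And (Var 0) (Neg (Var 0))).

Fixpoint subst (sigma : nat -> formula) (phi : formula) : formula :=
  match phi with
  | Var n => sigma n
  | Neg phi1 => Neg (subst sigma phi1)
  | And phi1 phi2 => And (subst sigma phi1) (subst sigma phi2)
  | L r phi1 => L r (subst sigma phi1)
  end.

(* [v] and [w] assign arbitrary truth values to the propositional letters and
   to the formulas [L r phi], all of which count as propositional atoms. *)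
Fixpoint eval (v : nat -> bool) (w : index -> formula -> bool)
    (phi : formula) : bool :=
  match phi with
  | Var n => v n
  | Neg phi1 => ~~ eval v w phi1
  | And phi1 phi2 => eval v w phi1 && eval v w phi2
  | L r phi1 => w r phi1
  end.

Definition tautology (phi : formula) : Prop :=
  forall v w, eval v w phi = true.

Record is_logic (S : formula -> Prop) : Prop := IsLogic {
  logic_taut : forall phi, tautology phi -> S phi;
  logic_mp : forall phi psi, S (Imp phi psi) -> S phi -> S psi;
  logic_subst : forall sigma phi, S phi -> S (subst sigma phi)
}.

(* In A3 and A4 the index [u] stands for the sum; since it ranges over
   [index], it exists exactly when that sum is at most 1. *)
Record is_SigmaH_logic (S : formula -> Prop) : Prop := IsSigmaHLogic {
  SigmaH_logic : is_logic S;
  SigmaH_A1 : forall phi, S (L index0 phi);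
  SigmaH_A2 : forall r, S (L r Top);
  SigmaH_A3 : forall (r t u : index) phi psi, val u = val r + val t ->
    S (Imp (And (L r (And phi psi)) (L t (And phi (Neg psi)))) (L u phi));
  SigmaH_A4 : forall (r s u : index) phi psi, val u = val r + val s ->
    S (Imp (And (Neg (L r (And phi psi))) (Neg (L s (And phi (Neg psi)))))
           (Neg (L u phi)));
  SigmaH_A5 : forall (r s : index) phi, 1 < val r + val s ->
    S (Imp (L r phi) (Neg (L s (Neg phi))));
  SigmaH_4p : forall r phi, S (Imp (L r phi) (L index1 (L r phi)));
  SigmaH_5p : forall r phi, S (Imp (Neg (L r phi)) (L index1 (Neg (L r phi))));
  SigmaH_DIS : forall r phi psi, S (Iff phi psi) -> S (Iff (L r phi) (L r psi));
  SigmaH_ARCH : forall (r : index) gamma phi,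
    (forall s : index, val s < val r -> S (Imp gamma (L s phi))) ->
    S (Imp gamma (L r phi))
}.

Definition SigmaH (phi : formula) : Prop :=
  forall S, is_SigmaH_logic S -> S phi.

Lemma SigmaH_is_SigmaH_logic : is_SigmaH_logic SigmaH.
Proof.
split; first split.
- by move=> phi tphi S HS; apply: (logic_taut (SigmaH_logic HS)).
- move=> phi psi Hi Hp S HS.
  exact: (logic_mp (SigmaH_logic HS) (Hi S HS) (Hp S HS)).
- by move=> sigma phi Hp S HS; apply: (logic_subst (SigmaH_logic HS)); apply: Hp.
- by move=> phi S HS; apply: SigmaH_A1.
- by move=> r S HS; apply: SigmaH_A2.
- by move=> r t u phi psi e S HS; apply: SigmaH_A3 e.
- by move=> r s u phi psi e S HS; apply: SigmaH_A4 e.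
- by move=> r s phi h S HS; apply: SigmaH_A5.
- by move=> r phi S HS; apply: SigmaH_4p.
- by move=> r phi S HS; apply: SigmaH_5p.
- by move=> r phi psi H S HS; apply: SigmaH_DIS => //; apply: H.
- by move=> r gamma phi H S HS; apply: SigmaH_ARCH => // s sr; apply: H.
Qed.

(* The Boolean combinations of formulas satisfying [G]; each one uses only
   finitely many members of [G]. *)
Inductive bool_comb (G : formula -> Prop) : formula -> Prop :=
| bool_comb_base phi : G phi -> bool_comb G phi
| bool_comb_neg phi : bool_comb G phi -> bool_comb G (Neg phi)
| bool_comb_and phi psi :
    bool_comb G phi -> bool_comb G psi -> bool_comb G (And phi psi).

Definition is_L (phi : formula) : Prop := exists r psi, phi = L r psi.

Definition is_posL (phi : formula) : Prop :=
  exists (r : index) psi, 0 < val r /\ phi = L r psi.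

(* [G] is an auxiliary set of normal formulas. Quantifying over it, instead of
   nesting [normal] under [bool_comb], yields a usable induction principle. *)
Inductive normal : formula -> Prop :=
| normal_depth phi : (depth phi <= 1)%N -> normal phi
| normal_bool (G : formula -> Prop) phi :
    (forall chi, G chi -> is_L chi) ->
    (forall chi, G chi -> normal chi) ->
    bool_comb G phi -> normal phi
| normal_L (G : formula -> Prop) (r : index) phi psi :
    0 < val r -> normal (L r phi) ->
    (forall chi, G chi -> is_posL chi) ->
    (forall chi, G chi -> normal chi) ->
    bool_comb G psi -> normal (L r psi)
| normal_L_and (G : formula -> Prop) (r : index) phi psi :
    0 < val r -> normal (L r phi) ->
    (forall chi, G chi -> is_posL chi) ->
    (forall chi, G chi -> normal chi) ->
    bool_comb G psi -> normal (L r (And phi psi))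
| normal_L_or (G : formula -> Prop) (r : index) phi psi :
    0 < val r -> normal (L r phi) ->
    (forall chi, G chi -> is_posL chi) ->
    (forall chi, G chi -> normal chi) ->
    bool_comb G psi -> normal (L r (Or phi psi)).

(* Main.v *)
Require Import Defs.
From mathcomp Require Import all_boot all_order all_algebra.

(** A formula [L_s chi] is rigid: by the introspection axioms 4p and 5p,
    provably either it or its negation has probability 1, according to whether
    it holds.  Rigidity passes to Boolean combinations, and a rigid [psi] can
    be pulled out of any modality [L_r] with [r > 0]:
    - [L_r psi <-> psi] ([rigid_L]),
    - [L_r (phi /\ psi) <-> L_r phi /\ psi] ([rigid_L_and]),
    - [L_r (phi \/ psi) <-> L_r phi \/ psi] ([rigid_L_or]).
    All three rest on [L_and_certain]: intersecting with an event of
    probability 1 does not change a probability.  Finite additivity gives this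
    only up to an arbitrarily small rational, and the rule ARCH removes the
    error.

    The theorem follows by induction on normality.  In each of the three
    modal clauses the right-hand side above is a Boolean combination of
    [L_r phi] and of the atoms of [psi], all of which are normal and hence
    already equivalent to formulas of depth at most 1. *)

Set Implicit Arguments.
Unset Strict Implicit.
Unset Printing Implicit Defensive.

Import Order.TTheory GRing.Theory Num.Theory.
Local Open Scope ring_scope.

(** * Propositional reasoning *)

Lemma SigmaH_taut phi : tautology phi -> SigmaH phi.
Proof. exact: (logic_taut (SigmaH_logic SigmaH_is_SigmaH_logic)). Qed.

Lemma SigmaH_mp phi psi : SigmaH (Imp phi psi) -> SigmaH phi -> SigmaH psi.
Proof.
move=> Himp Hphi.
exact: (logic_mp (SigmaH_logic SigmaH_is_SigmaH_logic) Himp Hphi).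
Qed.

Lemma SigmaH_conseq1 a c :
  (forall v w, eval v w a -> eval v w c) -> SigmaH a -> SigmaH c.
Proof.
move=> ac; apply: SigmaH_mp; apply: SigmaH_taut => v w /=.
by apply/negP => /andP[/ac ->].
Qed.

Lemma SigmaH_conseq2 a b c :
  (forall v w, eval v w a -> eval v w b -> eval v w c) ->
  SigmaH a -> SigmaH b -> SigmaH c.
Proof.
move=> abc Ha; apply: SigmaH_mp; apply: SigmaH_conseq1 Ha => v w /= ea.
by apply/negP => /andP[/(abc _ _ ea) ->].
Qed.

Lemma SigmaH_conseq3 a b c d :
  (forall v w, eval v w a -> eval v w b -> eval v w c -> eval v w d) ->
  SigmaH a -> SigmaH b -> SigmaH c -> SigmaH d.
Proof.
move=> abcd Ha Hb; apply: SigmaH_mp.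
apply: SigmaH_conseq2 Ha Hb => v w /= ea eb.
by apply/negP => /andP[/(abcd _ _ ea eb) ->].
Qed.

(** The entries of the table are the values of unspecified formulas, of modal
    formulas [L r a], and of the letter that [Top] unfolds to. *)
Ltac truth_table :=
  move=> v w /=;
  repeat match goal with
  | |- context [eval ?v ?w ?a] => case: (eval v w a)
  | |- context [?w ?r ?a] =>
      match type of w with Defs.index -> formula -> bool => case: (w r a) end
  | |- context [?v ?n] => match type of v with nat -> bool => case: (v n) end
  end; by [].

(** * Probabilistic reasoning *)

Lemma index_le1 (r : Defs.index) : val r <= 1.
Proof. by case/andP: (valP r). Qed.

Lemma index_diff (s r : Defs.index) : val s <= val r ->
  exists t : Defs.index, val r = val s + val t.
Proof.
move=> sr; suff t01 : 0 <= val r - val s <= 1.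
  by exists (exist _ (val r - val s) t01); rewrite /= addrC subrK.
rewrite subr_ge0 sr lerBlDr (le_trans (index_le1 r)) // lerDl.
by case/andP: (valP s).
Qed.

(** Since [phi] amounts to [psi /\ phi], axiom A3 applies with the trivial
    bound [L_0 (psi /\ ~ phi)] for the rest of [psi]. *)
Lemma L_mono r phi psi :
  SigmaH (Imp phi psi) -> SigmaH (Imp (L r phi) (L r psi)).
Proof.
move=> imp.
have dis : SigmaH (Iff (L r phi) (L r (And psi phi))).
  apply: (SigmaH_DIS SigmaH_is_SigmaH_logic).
  by apply: SigmaH_conseq1 imp; truth_table.
have add : SigmaH (Imp (And (L r (And psi phi)) (L index0 (And psi (Neg phi))))
                       (L r psi)).
  by apply: (SigmaH_A3 SigmaH_is_SigmaH_logic); rewrite addr0.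
apply: SigmaH_conseq3 dis add
  (SigmaH_A1 SigmaH_is_SigmaH_logic (And psi (Neg phi))); truth_table.
Qed.

Lemma L1_excludes_Neg (r : Defs.index) phi : 0 < val r ->
  SigmaH (Imp (L index1 phi) (Neg (L r (Neg phi)))).
Proof.
by move=> r0; apply: (SigmaH_A5 SigmaH_is_SigmaH_logic); rewrite ltrDl.
Qed.

(** For [s < r], axiom A4 splits [L_r phi] into [L_s (phi /\ psi)] or
    [L_(r-s) (phi /\ ~ psi)], and the latter is incompatible with [L_1 psi]. *)
Lemma L_and_certain (r : Defs.index) phi psi :
  SigmaH (Imp (And (L r phi) (L index1 psi)) (L r (And phi psi))).
Proof.
apply: (SigmaH_ARCH SigmaH_is_SigmaH_logic) => s sr.
have [t rE] := index_diff (ltW sr).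
have t0 : 0 < val t by rewrite -(ltrDl (val s)) -rE.
have split_r := SigmaH_A4 SigmaH_is_SigmaH_logic phi psi rE.
have drop_phi : SigmaH (Imp (L t (And phi (Neg psi))) (L t (Neg psi))).
  by apply: L_mono; apply: SigmaH_taut; truth_table.
apply: SigmaH_conseq3 split_r drop_phi (L1_excludes_Neg psi t0); truth_table.
Qed.

(** [Top] has probability at least [r] by A2; intersect it with [phi]. *)
Lemma L1_weaken (r : Defs.index) phi : SigmaH (Imp (L index1 phi) (L r phi)).
Proof.
have drop_top : SigmaH (Imp (L r (And Top phi)) (L r phi)).
  by apply: L_mono; apply: SigmaH_taut; truth_table.
apply: SigmaH_conseq3 (L_and_certain r Top phi) drop_top
  (SigmaH_A2 SigmaH_is_SigmaH_logic r); truth_table.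
Qed.

(** * Rigid formulas *)

Definition rigid psi :=
  SigmaH (Imp psi (L index1 psi)) /\ SigmaH (Imp (Neg psi) (L index1 (Neg psi))).

Lemma rigid_Neg psi : rigid psi -> rigid (Neg psi).
Proof.
move=> [pos neg]; split=> //.
have dneg : SigmaH (Imp (L index1 psi) (L index1 (Neg (Neg psi)))).
  by apply: L_mono; apply: SigmaH_taut; truth_table.
apply: SigmaH_conseq2 pos dneg; truth_table.
Qed.

Lemma rigid_And phi psi : rigid phi -> rigid psi -> rigid (And phi psi).
Proof.
move=> [pos1 neg1] [pos2 neg2]; split.
  by apply: SigmaH_conseq3 pos1 pos2 (L_and_certain index1 phi psi); truth_table.
have mono1 : SigmaH (Imp (L index1 (Neg phi)) (L index1 (Neg (And phi psi)))).
  by apply: L_mono; apply: SigmaH_taut; truth_table.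
have mono2 : SigmaH (Imp (L index1 (Neg psi)) (L index1 (Neg (And phi psi)))).
  by apply: L_mono; apply: SigmaH_taut; truth_table.
have case1 : SigmaH (Imp (Neg phi) (L index1 (Neg (And phi psi)))).
  by apply: SigmaH_conseq2 neg1 mono1; truth_table.
apply: SigmaH_conseq3 case1 neg2 mono2; truth_table.
Qed.

Lemma rigid_bool_comb (G : formula -> Prop) psi :
  (forall chi, G chi -> is_posL chi) -> bool_comb G psi -> rigid psi.
Proof.
move=> GL; elim=> [chi /GL [s [theta [_ ->]]]|chi _|chi theta _ IH1 _ IH2].
- split; first exact: (SigmaH_4p SigmaH_is_SigmaH_logic).
  exact: (SigmaH_5p SigmaH_is_SigmaH_logic).
- exact: rigid_Neg.
- exact: rigid_And.
Qed.

(** From left to right: were [psi] false, [~ psi] would have probability 1,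
    leaving no room for a positive probability of [psi]. *)
Lemma rigid_L (r : Defs.index) psi : 0 < val r -> rigid psi ->
  SigmaH (Iff (L r psi) psi).
Proof.
move=> r0 [pos neg].
have dneg : SigmaH (Imp (L r psi) (L r (Neg (Neg psi)))).
  by apply: L_mono; apply: SigmaH_taut; truth_table.
have L_elim : SigmaH (Imp (L r psi) psi).
  by apply: SigmaH_conseq3 neg dneg (L1_excludes_Neg (Neg psi) r0); truth_table.
apply: SigmaH_conseq3 L_elim pos (L1_weaken r psi); truth_table.
Qed.

Lemma rigid_L_and (r : Defs.index) phi psi : 0 < val r -> rigid psi ->
  SigmaH (Iff (L r (And phi psi)) (And (L r phi) psi)).
Proof.
move=> r0 rig.
have fst_and : SigmaH (Imp (L r (And phi psi)) (L r phi)).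
  by apply: L_mono; apply: SigmaH_taut; truth_table.
have snd_and : SigmaH (Imp (L r (And phi psi)) (L r psi)).
  by apply: L_mono; apply: SigmaH_taut; truth_table.
have elim : SigmaH (Imp (L r (And phi psi)) (And (L r phi) psi)).
  by apply: SigmaH_conseq3 fst_and snd_and (rigid_L r0 rig); truth_table.
case: rig => pos _.
apply: SigmaH_conseq3 elim pos (L_and_certain r phi psi); truth_table.
Qed.

(** From left to right: were [psi] false, [~ psi] would have probability 1, and
    [phi \/ psi] restricted to that event entails [phi]. *)
Lemma rigid_L_or (r : Defs.index) phi psi : 0 < val r -> rigid psi ->
  SigmaH (Iff (L r (Or phi psi)) (Or (L r phi) psi)).
Proof.
move=> r0 rig.
have inl : SigmaH (Imp (L r phi) (L r (Or phi psi))).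
  by apply: L_mono; apply: SigmaH_taut; truth_table.
have inr : SigmaH (Imp (L r psi) (L r (Or phi psi))).
  by apply: L_mono; apply: SigmaH_taut; truth_table.
have intro : SigmaH (Imp (Or (L r phi) psi) (L r (Or phi psi))).
  by apply: SigmaH_conseq3 inl inr (rigid_L r0 rig); truth_table.
have cut : SigmaH (Imp (L r (And (Or phi psi) (Neg psi))) (L r phi)).
  by apply: L_mono; apply: SigmaH_taut; truth_table.
case: rig => _ neg.
have elim : SigmaH (Imp (L r (Or phi psi)) (Or (L r phi) psi)).
  apply: SigmaH_conseq3 neg (L_and_certain r (Or phi psi) (Neg psi)) cut.
  truth_table.
apply: SigmaH_conseq2 intro elim; truth_table.
Qed.

(** * Reduction to depth 1 *)

Definition flattenable phi :=
  exists phi', (depth phi' <= 1)%N /\ SigmaH (Iff phi phi').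

Lemma flattenable_iff phi psi :
  SigmaH (Iff phi psi) -> flattenable psi -> flattenable phi.
Proof.
move=> e1 [psi' [d e2]]; exists psi'; split=> //.
apply: SigmaH_conseq2 e1 e2; truth_table.
Qed.

Lemma flattenable_Neg phi : flattenable phi -> flattenable (Neg phi).
Proof.
move=> [phi' [d e]]; exists (Neg phi'); split=> //.
apply: SigmaH_conseq1 e; truth_table.
Qed.

Lemma flattenable_And phi psi :
  flattenable phi -> flattenable psi -> flattenable (And phi psi).
Proof.
move=> [phi' [d1 e1]] [psi' [d2 e2]]; exists (And phi' psi').
split; first by rewrite /= geq_max d1.
apply: SigmaH_conseq2 e1 e2; truth_table.
Qed.

Lemma flattenable_bool_comb (G : formula -> Prop) psi :
  (forall chi, G chi -> flattenable chi) -> bool_comb G psi -> flattenable psi.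
Proof.
move=> GP; elim=> [chi /GP //|chi _|chi theta _ IH1 _ IH2].
- exact: flattenable_Neg.
- exact: flattenable_And.
Qed.

Theorem corollary3p15 (phi : formula) (normal_phi : normal phi) :
  exists phi' : formula, (depth phi' <= 1)%N /\ SigmaH (Iff phi phi').
Proof.
rewrite -/(flattenable phi); elim: phi / normal_phi.
- by move=> phi d; exists phi; split=> //; apply: SigmaH_taut; truth_table.
- by move=> G phi _ _ IH; apply: flattenable_bool_comb.
- move=> G r phi psi r0 _ _ GL _ IH comb.
  apply: flattenable_iff (rigid_L r0 (rigid_bool_comb GL comb)) _.
  exact: flattenable_bool_comb comb.
- move=> G r phi psi r0 _ IHphi GL _ IH comb.
  apply: flattenable_iff
    (rigid_L_and phi r0 (rigid_bool_comb GL comb)) _.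
  by apply: flattenable_And => //; apply: flattenable_bool_comb comb.
- move=> G r phi psi r0 _ IHphi GL _ IH comb.
  apply: flattenable_iff
    (rigid_L_or phi r0 (rigid_bool_comb GL comb)) _.
  have flat_psi : flattenable psi by apply: flattenable_bool_comb comb.
  by apply: flattenable_Neg; apply: flattenable_And; apply: flattenable_Neg.
Qed.
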